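(* Consider the agglomeration phase of P-RASTER (described in the context) applied to a finite set $S\subset\mathbb{Z}^2$ of significant tiles with minimum cluster size $\mu$. The set of output clusters does not depend on the slicing: for any number $N\ge 1$ of slices and any choice of borders $b_1<\dots<b_{N-1}$, the output is the same as the output obtained with no slicing ($N=1$), namely the set of clusters of $S$ (connected components of the neighbor graph on $S$) having at least $\mu$ tiles.
   Context: Tiles are integer grid cells $(x,y)\in\mathbb{Z}^2$. Two tiles are neighbors if their Chebyshev distance is exactly $1$ (the eight surrounding cells). For a set of tiles, its clusters are the connected components of the graph on those tiles whose edges join neighboring tiles. Two sets of tiles are adjacent if some tile of one is a neighbor of some tile of the other. P-RASTER agglomeration. Input: a finite set $S$ of significant tiles, a minimum cluster size $\mu$, and integers $b_1<\dots<b_{N-1}$ (vertical borders). Put $b_0=-\infty$, $b_N=+\infty$; slice $k$ ($1\le k\le N$) consists of the tiles of $S$ with $b_{k-1}\le x<b_k$, and border $B_k$ ($1\le k\le N-1$) separates slices $k$ and $k+1$. A set of tiles touches $B_k$ if it contains a tile with $x=b_k-1$ or $x=b_k$. Step 1 (in parallel per slice): compute the clusters of the tiles of each slice (per-slice clusters); a per-slice cluster touching some border is put into the candidate set $C_b$; otherwise it is output if it has at least $\mu$ tiles and discarded otherwise. Step 2 (joining, for $i=N-1,N-2,\dots,1$ in this order): let $C_{lr}$ be the clusters in $C_b$ that touch $B_i$; repeatedly merge clusters of $C_{lr}$ that are adjacent (a depth-first search over clusters, merging each newly found adjacent cluster into the current joined cluster) until the elements of $C_{lr}$ are grouped into maximal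 joined clusters; each joined cluster that touches $B_{i-1}$ is returned to $C_b$ as a candidate for the next border (replacing its constituents), and each other joined cluster is output if it has at least $\mu$ tiles and discarded otherwise. The output is the set of all output clusters. *)

(* Defs.v *)
From mathcomp Require Import all_boot all_order all_algebra.
From mathcomp Require Import finmap.

Set Implicit Arguments.
Unset Strict Implicit.
Unset Printing Implicit Defensive.

Import Order.TTheory GRing.Theory Num.Theory.
Local Open Scope ring_scope.
Local Open Scope fset_scope.

Definition tile : Type := (int * int)%type.

Definition neighbor (s t : tile) : bool :=
  Num.max `|s.1 - t.1| `|s.2 - t.2| == 1.

Definition adjacent (A B : {fset tile}) : bool :=
  has (fun s => has (neighbor s) B) A.

Definition cluster_of (S : {fset tile}) (x : S) : {fset tile} :=
  [fset val y | y in connect (fun s t : S => neighbor (val s) (val t)) x].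

Definition clusters (S : {fset tile}) : {fset {fset tile}} :=
  [fset cluster_of x | x : S].

Definition large_clusters (mu : nat) (C : {fset {fset tile}}) :
    {fset {fset tile}} :=
  [fset c in C | (mu <= #|` c|)%N].

(* Borders are given by the list [:: b_1; ...; b_(N-1)], so N = (size b).+1.
   The list -oo :: b, read with default +oo, gives b_0 = -oo and b_N = +oo;
   BLeft makes slice k the tiles with b_(k-1) <= x < b_k. *)
Definition bound (b : seq int) (k : nat) : itv_bound int :=
  nth +oo%O (-oo%O :: [seq BLeft c | c <- b]) k.

Definition slice (b : seq int) (S : {fset tile}) (k : nat) : {fset tile} :=
  [fset t in S | t.1 \in Interval (bound b k.-1) (bound b k)].

(* The range condition reflects that B_0 and B_N are not touched by any
   tile. *)
Definition touches (b : seq int) (k : nat) (C : {fset tile}) : bool :=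
  (0 < k <= size b)%N &&
  has (fun t : tile => (t.1 == b`_k.-1 - 1) || (t.1 == b`_k.-1)) C.

Definition touches_some (b : seq int) (C : {fset tile}) : bool :=
  has (fun k => touches b k C) (iota 1 (size b)).

Definition slice_clusters (b : seq int) (S : {fset tile}) :
    {fset {fset tile}} :=
  \bigcup_(k <- iota 1 (size b).+1) clusters (slice b S k).

(* [dfs_visit c J U J' U'] : depth-first search from the already visited
   cluster c, where J is the current joined cluster and U the set of unvisited
   clusters, may end with joined cluster J' and unvisited clusters U'.  It is a
   relation because the order in which adjacent clusters are found is
   arbitrary. *)
Inductive dfs_visit (c : {fset tile}) (J : {fset tile})
    (U : {fset {fset tile}}) : {fset tile} -> {fset {fset tile}} -> Prop :=
| DfsDone :
    (forall d, d \in U -> ~~ adjacent c d) -> dfs_visit c J U J U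
| DfsNext d J1 U1 J2 U2 :
    d \in U -> adjacent c d ->
    dfs_visit d (J `|` d) (U `\ d) J1 U1 ->
    dfs_visit c J1 U1 J2 U2 ->
    dfs_visit c J U J2 U2.

(* [join U Js] : the clusters in U may be grouped into the set Js of joined
   clusters. *)
Inductive join : {fset {fset tile}} -> {fset {fset tile}} -> Prop :=
| JoinDone : join fset0 fset0
| JoinNext U c J U1 Js :
    c \in U -> dfs_visit c c (U `\ c) J U1 -> join U1 Js -> join U (J |` Js).

(* Processing of the borders B_i, ..., B_1, in this order, from candidates Cb
   and clusters out already output; res is the final output. *)
Fixpoint join_borders (b : seq int) (mu i : nat)
    (Cb out res : {fset {fset tile}}) : Prop :=
  if i is j.+1 then
    exists2 Js, join [fset c in Cb | touches b i c] Js &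
      join_borders b mu j
        ([fset c in Cb | ~~ touches b i c] `|` [fset c in Js | touches b j c])
        (out `|` large_clusters mu [fset c in Js | ~~ touches b j c])
        res
  else res = out.

Definition praster (b : seq int) (mu : nat) (S : {fset tile})
    (res : {fset {fset tile}}) : Prop :=
  join_borders b mu (size b)
    [fset c in slice_clusters b S | touches_some b c]
    (large_clusters mu [fset c in slice_clusters b S | ~~ touches_some b c])
    res.

(* Main.v *)
(* Before border [B_i] is processed, the candidates together with the clusters
   already output or discarded are exactly the clusters of [S] for the neighbor
   relation restricted to pairs not separated by any of [B_1, ..., B_i].  Two
   neighbors separated by a border lie on its two sides, so the clusters that
   have to be merged when [B_i] is removed all touch [B_i], and joining those
   re-establishes the invariant for [i - 1].  A joined cluster lies to the right
   of [B_(i-1)], so it touches one of [B_1, ..., B_(i-1)] only if it touches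
   [B_(i-1)], and the candidates remain those that touch a border.
   For [i = 0] the invariant describes the clusters of [S]. *)
Require Import Defs.
From mathcomp Require Import all_boot all_order all_algebra.
From mathcomp Require Import finmap.
From mathcomp Require Import zify.
Set Implicit Arguments.
Unset Strict Implicit.
Unset Printing Implicit Defensive.
Import Order.TTheory GRing.Theory Num.Theory.
Local Open Scope ring_scope.
Local Open Scope fset_scope.

(** * Connectivity, sides of borders, closeness *)

Definition neighbor_closed (S : {fset tile}) (Q : pred tile) : Prop :=
  forall s t, s \in S -> t \in S -> neighbor s t -> Q s = Q t.

(** For [c] inside [S] this means that [c] lies in one connected component of [S]. Testing with
    closed predicates instead of paths turns gluing along an edge into a chain of equalities. *)
Definition indivisible (S c : {fset tile}) : Prop :=
  forall Q, neighbor_closed S Q -> {in c &, forall s t, Q s = Q t}.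

(** Entries of [b] are counted from 0, so [m < i] ranges over B_1, ..., B_i. *)
Definition same_side (b : seq int) (i : nat) (s t : tile) : Prop :=
  forall m, (m < i)%N -> (s.1 < b`_m) = (t.1 < b`_m).

(** Allowing equality lets one condition express both disjointness of clusters and the absence of
    edges between them. *)
Definition close (s t : tile) : Prop := s = t \/ neighbor s t.

Lemma neighbor_sym s t : neighbor s t = neighbor t s.
Proof. by rewrite /neighbor distrC [X in Num.max _ X]distrC. Qed.

Lemma close_sym s t : close s t -> close t s.
Proof. by case=> [->|]; [left | rewrite neighbor_sym; right]. Qed.

Lemma close_dist s t : close s t -> `|s.1 - t.1| <= 1.
Proof.
case=> [->|]; first by rewrite subrr normr0.
by move=> /eqP <-; rewrite le_max lexx.
Qed.

(** * Adjacency, depth-first search and joining *)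

Lemma adjacentP (A B : {fset tile}) :
  reflect (exists s t, [/\ s \in A, t \in B & neighbor s t]) (adjacent A B).
Proof.
apply: (iffP hasP) => [[s sA /hasP[t tB nst]]|[s [t [sA tB nst]]]].
  by exists s, t.
by exists s => //; apply/hasP; exists t.
Qed.

(** The found clusters are those of [U] outside [U']. The search leaves a cluster only when no
    unvisited cluster is adjacent to it, and the unvisited set only shrinks, so no found cluster is
    adjacent to a remaining one. *)
Lemma dfs_visitP c J U J' U' : dfs_visit c J U J' U' ->
  [/\ U' `<=` U, J `<=` J',
      forall t, t \in J' -> t \in J \/ exists2 d, d \in U `\` U' & t \in d,
      forall d, d \in U `\` U' -> d `<=` J' &
      forall d e, d \in c |` U `\` U' -> e \in U' -> ~~ adjacent d e].
Proof.
elim=> {c J U J' U'} [c J U nadj|c J U d J1 U1 J2 U2 dU cd _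
    [sU1 sJ1 J1P U1J1 nadj1] _ [sU2 sJ2 J2P U2J2 nadj2]].
  split=> // [t|d|d e]; rewrite ?fsetDv ?in_fset0 //; first by left.
  by rewrite fsetU0 => /fset1P->; apply: nadj.
have sU1U : U1 `<=` U by apply: fsubset_trans sU1 (fsubsetDl _ _).
have nadjU e f : e \in U -> e \notin U1 -> f \in U1 -> ~~ adjacent e f.
  move=> eU eU1; apply: nadj1; rewrite !inE eU eU1 !andbT.
  by case: eqP.
have J1J2 t : t \in J1 -> t \in J2 by apply/fsubsetP.
split.
- exact: fsubset_trans sU2 sU1U.
- apply: fsubset_trans sJ2; apply: fsubset_trans sJ1; exact: fsubsetUl.
- move=> t /J2P[/J1P[/fsetUP[|td]|[e]]|[e]].
  + by left.
  + right; exists d => //; rewrite !inE dU andbT.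
    apply: contraTN sU2 => dU2.
    by apply/negP=> /fsubsetP/(_ _ dU2)/(fsubsetP sU1); rewrite !inE eqxx.
  + rewrite !inE => /and3P[eU1 _ eU] te; right; exists e => //.
    by rewrite !inE eU andbT; apply: contra eU1; apply/fsubsetP.
  + rewrite !inE => /andP[eU2 eU1] te; right; exists e => //.
    by rewrite !inE eU2 (fsubsetP sU1U).
- move=> e; rewrite !inE => /andP[eU2 eU].
  have [eU1|eU1] := boolP (e \in U1).
    by apply: U2J2; rewrite !inE eU1 eU2.
  apply: fsubset_trans sJ2.
  have [->|ed] := eqVneq e d.
    by apply: fsubset_trans sJ1; apply: fsubsetUr.
  by apply: U1J1; rewrite !inE eU1 ed eU.
- move=> e f; rewrite !inE => /orP[ec|/andP[eU2 eU]] fU2.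
    by apply: nadj2 => //; rewrite !inE ec.
  have [eU1|eU1] := boolP (e \in U1).
    by apply: nadj2 => //; rewrite !inE eU1 eU2 orbT.
  by apply: nadjU => //; apply: (fsubsetP sU2).
Qed.

(** Both recursive searches run on sets without [d], so induction on the number of unvisited
    clusters applies. *)
Lemma dfs_visit_ex c J U : exists J' U', dfs_visit c J U J' U'.
Proof.
have [n] := ubnP #|` U|; elim: n => // n IHn in c J U * => ltUn.
have [/hasP[d dU cd]|/hasPn nadj] := boolP (has (adjacent c) U); last first.
  by exists J, U; left.
have ltUd : (#|` U `\ d| < n)%N.
  by move: ltUn; rewrite (cardfsD1 d U) dU; lia.
have [J1 [U1 v1]] := IHn d (J `|` d) (U `\ d) ltUd.
have [sU1 _ _ _ _] := dfs_visitP v1.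
have [J2 [U2 v2]] := IHn c J1 U1 (leq_ltn_trans (fsubset_leq_card sU1) ltUd).
by exists J2, U2; exact: (DfsNext dU cd v1 v2).
Qed.

Lemma join_ex U : exists Js, join U Js.
Proof.
have [n] := ubnP #|` U|; elim: n => // n IHn in U * => ltUn.
have [->|[c cU]] := fset_0Vmem U; first by exists fset0; left.
have [J [U1 v]] := dfs_visit_ex c c (U `\ c).
have [sU1 _ _ _ _] := dfs_visitP v.
have [|Js jJs] := IHn U1; last by exists (J |` Js); exact: (JoinNext cU v jJs).
apply: leq_ltn_trans (fsubset_leq_card sU1) _.
by move: ltUn; rewrite (cardfsD1 c U) cU; lia.
Qed.

(** Since [c] is part of [J], adjacency of [c] and [d] gives an edge between [J] and [d]. A closed
    predicate agrees at its ends, hence is constant on the union. *)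
Lemma dfs_visit_indivisible S c J U J' U' : dfs_visit c J U J' U' ->
  (forall d, d \in c |` U -> d `<=` S) ->
  (forall d, d \in U -> indivisible S d) -> c `<=` J ->
  indivisible S J -> indivisible S J'.
Proof.
elim=> {c J U J' U'} // c J U d J1 U1 J2 U2 dU cd v1 IH1 v2 IH2 sS iU cJ iJ.
have [sU1 sJ1 _ _ _] := dfs_visitP v1.
have [sU2 sJ2 _ _ _] := dfs_visitP v2.
have sUd e : e \in U `\ d -> e \in U by rewrite !inE => /andP[].
have sU1U e : e \in U1 -> e \in U by move/(fsubsetP sU1)/sUd.
apply: IH2.
- by move=> e /fset1UP[->|/sU1U eU]; apply: sS; rewrite !inE ?eqxx ?eU ?orbT.
- by move=> e /sU1U/iU.
- by apply: fsubset_trans cJ _; apply: fsubset_trans sJ1; apply: fsubsetUl.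
apply: IH1.
- by move=> e /fset1UP[->|/sUd eU]; apply: sS; rewrite !inE ?dU ?eU orbT.
- by move=> e /sUd/iU.
- exact: fsubsetUr.
move=> Q clQ; have [s [t [sc td nst]]] := adjacentP _ _ cd.
have Qst : Q s = Q t.
  apply: clQ => //; first by apply: (fsubsetP (sS c _)) => //; rewrite !inE eqxx.
  by apply: (fsubsetP (sS d _)) => //; rewrite !inE dU orbT.
have QJ u : u \in J `|` d -> Q u = Q s.
  case/fsetUP=> [uJ|ud]; first exact: iJ (fsubsetP cJ _ sc).
  by rewrite Qst; apply: iU dU _ clQ _ _ ud td.
by move=> u v /QJ-> /QJ->.
Qed.

(** Each search ends with nothing found adjacent to what remains, so distinct joined clusters have
    no edge between them. Adjacency need not detect a shared tile, as no tile is its own neighbor;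
    hence the disjointness hypothesis. *)
Lemma joinP U Js : join U Js ->
  [/\ forall J t, J \in Js -> t \in J ->
        exists c, [/\ c \in U, t \in c & c `<=` J],
      forall c, c \in U -> exists2 J, J \in Js & c `<=` J,
      forall J, J \in Js -> exists2 c, c \in U & c `<=` J,
      (forall c d s, c \in U -> d \in U -> s \in c -> s \in d -> c = d) ->
      forall J K s t, J \in Js -> K \in Js -> s \in J -> t \in K ->
        close s t -> J = K &
      forall S, (forall c, c \in U -> c `<=` S /\ indivisible S c) ->
      forall J, J \in Js -> indivisible S J].
Proof.
elim=> {U Js} [|U c J U1 Js cU v _ [JsP UJs Js0 JsE JsI]]; first by split.
have [sU1 sJ JP UJ nadj] := dfs_visitP v.
have sU1U d : d \in U1 -> d \in U by move/(fsubsetP sU1); rewrite !inE => /andP[].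
have cU1 : c \notin U1.
  by apply/negP => /(fsubsetP sU1); rewrite !inE eqxx.
have JU t : t \in J -> exists d, [/\ d \in U, d \notin U1, t \in d & d `<=` J].
  case/JP=> [tc|[d dUU1 td]]; first by exists c.
  by move: (dUU1); rewrite !inE => /and3P[dU1 _ dU]; exists d; split=> //; apply: UJ.
have nadjU d e : d \in U -> d \notin U1 -> e \in U1 -> ~~ adjacent d e.
  by move=> dU dU1; apply: nadj; rewrite !inE dU dU1; case: eqP.
split.
- move=> K t /fset1UP[->|KJs] tK; first by have [d [dU _ td dJ]] := JU t tK; exists d.
  by have [d [dU1 td dK]] := JsP K t KJs tK; exists d; split=> //; apply: sU1U.
- move=> d dU; have [dU1|dU1] := boolP (d \in U1).
    by have [K KJs dK] := UJs d dU1; exists K => //; rewrite !inE KJs orbT.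
  exists J; first by rewrite !inE eqxx.
  have [->//|dc] := eqVneq d c.
  by apply: UJ; rewrite !inE dU1 dc dU.
- move=> K /fset1UP[->|/Js0[d /sU1U dU dK]]; first by exists c.
  by exists d.
- move=> disj.
  have sep K s t : K \in Js -> s \in J -> t \in K -> close s t -> False.
    move=> KJs /JU[d [dU dU1 sd _]] /(JsP _ _ KJs)[e [eU1 te _]] [st|nst].
      have de := disj d e s dU (sU1U _ eU1) sd.
      by rewrite de ?eU1 ?st in dU1.
    have /negP[] := nadjU d e dU dU1 eU1.
    by apply/adjacentP; exists s, t.
  move=> K L s t /fset1UP[->|KJs] /fset1UP[->|LJs] // sK tL st.
  - by case: (sep L s t).
  - by case: (sep K t s) => //; apply: close_sym.
  - apply: (JsE _ K L s t) => // d e u /sU1U dU /sU1U; exact: disj.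
- move=> S US K /fset1UP[->|KJs]; last by apply: JsI KJs => d /sU1U/US.
  apply: dfs_visit_indivisible v _ _ (fsubset_refl _) _.
  + move=> d; rewrite !inE => /orP[/eqP->|/andP[_ dU]].
      by case: (US c cU).
    by case: (US d dU).
  + by move=> d; rewrite !inE => /andP[_ /US[]].
  by case: (US c cU).
Qed.

(** * The invariant and connected components *)

(* [P] stands for the candidates together with the clusters already output or
   discarded. *)
Record clustering (b : seq int) (S : {fset tile}) (i : nat)
    (P : {fset {fset tile}}) : Prop := Clustering {
  clustering_cover : forall t, t \in S -> exists2 c, c \in P & t \in c;
  clustering_sub : forall c, c \in P -> c `<=` S;
  clustering_neq0 : forall c, c \in P -> exists t, t \in c;
  clustering_side : forall c s t,
    c \in P -> s \in c -> t \in c -> same_side b i s t;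
  clustering_close : forall c d s t, c \in P -> d \in P -> s \in c -> t \in d ->
    close s t -> same_side b i s t -> c = d;
  clustering_indivisible : forall c, c \in P -> indivisible S c }.

Lemma mem_cluster_of (T : {fset tile}) (x y : T) :
  (val y \in cluster_of x) =
  connect (fun s t : T => neighbor (val s) (val t)) x y.
Proof.
apply/imfsetP/idP => [[z /= zx /val_inj->//]|xy]; by exists y.
Qed.

Lemma cluster_of_sub (T : {fset tile}) (x : T) : cluster_of x `<=` T.
Proof. by apply/fsubsetP=> t /imfsetP[y _ ->]; apply: valP. Qed.

Lemma clustersP (T c : {fset tile}) :
  reflect (exists x : T, c = cluster_of x) (c \in clusters T).
Proof.
apply: (iffP idP) => [/imfsetP[x _ ->]|[x ->]]; first by exists x.
by apply/imfsetP; exists x.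
Qed.

Lemma cluster_of_connect (T : {fset tile}) (x y : T) (Q : pred tile) :
  neighbor_closed T Q -> val y \in cluster_of x -> Q (val x) = Q (val y).
Proof.
rewrite mem_cluster_of => clQ.
apply: (@closed_connect _ _ [pred z : T | Q (val z)]) => s t /= nst.
by apply: clQ; rewrite ?valP.
Qed.

Lemma cluster_of_indivisible (T : {fset tile}) (x : T) :
  indivisible T (cluster_of x).
Proof.
move=> Q clQ s t /imfsetP[y /= yx ->] /imfsetP[z /= zx ->].
by rewrite -!(cluster_of_connect (x := x)) ?mem_cluster_of.
Qed.

Lemma cluster_of_closed (T : {fset tile}) (x : T) :
  neighbor_closed T [in cluster_of x].
Proof.
move=> s t sT tT nst.
have := mem_cluster_of x [` sT]; have := mem_cluster_of x [` tT] => /= -> ->.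
apply/idP/idP => xs; apply: connect_trans xs (connect1 _) => //=.
by rewrite neighbor_sym.
Qed.

Lemma cluster_of_eq (T : {fset tile}) (x y : T) :
  val x \in cluster_of y -> cluster_of x = cluster_of y.
Proof.
move=> xy; apply/fsetP=> t.
have Csym : connect_sym (fun s t : T => neighbor (val s) (val t)).
  by apply: sym_connect_sym => u v; apply: neighbor_sym.
rewrite mem_cluster_of in xy.
apply/imfsetP/imfsetP => -[z /= zx ->]; exists z => //=; rewrite !inE in zx *.
  exact: connect_trans xy zx.
by rewrite Csym in xy; apply: connect_trans xy zx.
Qed.

(** At [i = 0] the side condition is vacuous, so members of [P] are neighbor-closed as well as
    indivisible. Components of [S] have both properties too, and two such sets sharing a tile
    coincide, each serving as a test predicate for the other. *)
Lemma clustering0 b S P : clustering b S 0 P -> P = clusters S.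
Proof.
move=> [cov sub neq0 _ cl ind].
have clP c : c \in P -> neighbor_closed S [in c].
  move=> cP s t sS tS nst /=.
  have close' u v : u \in c -> v \in S -> neighbor u v -> v \in c.
    move=> uc vS nuv; have [d dP vd] := cov v vS.
    by rewrite (cl c d u v) //; right.
  by apply/idP/idP => /close'; apply=> //; rewrite neighbor_sym.
have clE c (x : S) : c \in P -> val x \in c -> c = cluster_of x.
  move=> cP xc; have xx : val x \in cluster_of x by rewrite mem_cluster_of.
  apply/fsetP=> t; apply/idP/idP => [tc|tx].
    have := ind c cP _ (@cluster_of_closed S x) t (val x) tc xc.
    by rewrite /= xx.
  by have <- := cluster_of_indivisible (clP c cP) xx tx.
apply/fsetP=> c; apply/idP/clustersP => [cP|[x ->]].
  have [t tc] := neq0 c cP; have tS := fsubsetP (sub c cP) _ tc.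
  by exists [` tS]; apply: clE.
have [c' c'P xc'] := cov (val x) (valP x).
by rewrite -(clE c' x).
Qed.

(** * Slices and the initial invariant *)

Lemma border_lt b i j : sorted (fun x y : int => x < y) b ->
  (i < j < size b)%N -> b`_i < b`_j.
Proof.
move=> sb /andP[ltij ltj].
by apply: (sorted_ltn_nth lt_trans 0 sb) => //; rewrite inE // (ltn_trans ltij).
Qed.

(** Sortedness extends the two bounds of the slice to all borders. Counting from 0, slice [k.+1]
    ends at entry [k] of [b], whence the threshold [k <= m]. *)
Lemma slice_side b S k t : sorted (fun x y : int => x < y) b ->
  (k <= size b)%N -> t \in slice b S k.+1 ->
  forall m, (m < size b)%N -> (t.1 < b`_m) = (k <= m)%N.
Proof.
move=> sb lekb; rewrite !inE /= => /andP[_ /andP[lo hi]] m ltmb.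
case: leqP => [lekm|ltmk]; last first.
  apply/negbTE; rewrite -leNgt.
  case: k lekb lo ltmk {hi} => // k lekb.
  rewrite /bound /= (nth_map 0) //= bnd_simp => lo ltmk.
  apply: le_trans lo.
  have [->//|nmk] := eqVneq m k; apply/ltW/border_lt => //; lia.
move: hi; rewrite /bound /= (nth_map 0) ?bnd_simp; last exact: leq_ltn_trans lekm ltmb.
move=> hi; apply: lt_le_trans hi _.
have [->//|nmk] := eqVneq m k; apply/ltW/border_lt => //; lia.
Qed.

Lemma slice_ex b S t : sorted (fun x y : int => x < y) b -> t \in S ->
  exists2 k, (k <= size b)%N & t \in slice b S k.+1.
Proof.
move=> sb tS; pose p (c : int) := t.1 < c.
(* The first border strictly right of [t] ends its slice. If there is none, [find] returns [size b],
   the last slice, whose right bound is the default [+oo]. *)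
exists (find p b); first exact: find_size.
rewrite !inE tS /=; apply/andP; rewrite /bound; split.
  case: (find p b) (@before_find _ 0 p b) (find_size p b) => // k nbk ltkb.
  rewrite /= (nth_map 0) // bnd_simp leNgt.
  by have := nbk k (ltnSn k); rewrite /p => ->.
have [hasp|nhasp] := boolP (has p b).
  by rewrite /= (nth_map 0) -?has_find // bnd_simp; apply: (nth_find 0 hasp).
by rewrite /= nth_default // size_map (hasNfind nhasp).
Qed.

Lemma slice_clustersP b S c :
  reflect (exists2 k, (k <= size b)%N & c \in clusters (slice b S k.+1))
          (c \in slice_clusters b S).
Proof.
apply: (iffP idP) => [/bigfcupP[k]|[k lekb ck]].
  rewrite mem_iota andbT => /andP[]; case: k => // k _ lekb ck.
  by exists k.
by apply/bigfcupP; exists k.+1 => //; rewrite mem_iota andbT.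
Qed.

Lemma slice_clusters_clustering b S : sorted (fun x y : int => x < y) b ->
  clustering b S (size b) (slice_clusters b S).
Proof.
move=> sb.
have subS k : slice b S k `<=` S by apply: fset_sub.
split.
- move=> t tS; have [k lekb tk] := slice_ex sb tS.
  exists (cluster_of [` tk]); last first.
    by rewrite -[X in X \in _]/(val [` tk]) mem_cluster_of.
  by apply/slice_clustersP; exists k => //; apply/clustersP; exists [` tk].
- move=> c /slice_clustersP[k _ /clustersP[x ->]].
  by apply: fsubset_trans (subS k.+1); apply: cluster_of_sub.
- move=> c /slice_clustersP[k _ /clustersP[x ->]].
  by exists (val x); rewrite mem_cluster_of.
- move=> c s t /slice_clustersP[k lekb /clustersP[x ->]].
  move=> /(fsubsetP (cluster_of_sub x)) sk /(fsubsetP (cluster_of_sub x)) tk.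
  move=> m ltm.
  by rewrite (slice_side sb lekb sk) // (slice_side sb lekb tk).
- move=> c d s t /slice_clustersP[k lekb /clustersP[x ->]].
  move=> /slice_clustersP[l lelb /clustersP[y ->]] sx ty st side.
  have sk := fsubsetP (cluster_of_sub x) _ sx.
  have tl := fsubsetP (cluster_of_sub y) _ ty.
  (* Entry [l] of [b], if it exists, ends slice [l.+1]: [t] lies left of it, hence so does [s], and
     [k <= l]. Otherwise [l] is already maximal. The converse is symmetric. *)
  have kl : k = l.
    apply/eqP; rewrite eqn_leq; apply/andP; split.
      have [|ltlb] := leqP (size b) l; first exact: leq_trans lekb.
      have := side l ltlb.
      by rewrite (slice_side sb lekb sk) // (slice_side sb lelb tl) // leqnn.
    have [|ltkb] := leqP (size b) k; first exact: leq_trans lelb.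
    have := side k ltkb.
    by rewrite (slice_side sb lekb sk) // (slice_side sb lelb tl) // leqnn => <-.
  subst l.
  rewrite -(@cluster_of_eq _ [` sk] x) // -(@cluster_of_eq _ [` tl] y) //.
  case: st => [st|nst]; first by congr cluster_of; apply: val_inj.
  by apply: cluster_of_eq; rewrite mem_cluster_of connect1 //= neighbor_sym.
- move=> c /slice_clustersP[k _ /clustersP[x ->]] Q clQ.
  apply: cluster_of_indivisible => s t /(fsubsetP (subS _)) sS /(fsubsetP (subS _)).
  exact: clQ.
Qed.

(** * Touching a border *)

Lemma touchesP b j c : (j < size b)%N ->
  reflect (exists2 t : tile, t \in c & t.1 = b`_j - 1 \/ t.1 = b`_j)
          (touches b j.+1 c).
Proof.
move=> ltj; rewrite /touches ltj /=; apply: (iffP hasP) => [[t tc]|[t tc tj]].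
  by case/orP=> /eqP tj; exists t; rewrite ?tj; auto.
by exists t => //; apply/orP; case: tj => ->; rewrite eqxx; auto.
Qed.

Lemma dist1_separated (x y z : int) :
  `|x - y| <= 1 -> (x < z) != (y < z) -> x = z - 1 \/ x = z.
Proof. lia. Qed.

(** First coordinates of close tiles differ by at most 1, so close tiles on opposite sides of a
    border both lie in the two columns that define touching it. *)
Lemma close_separated b j s t c : (j < size b)%N -> s \in c -> close s t ->
  ~~ touches b j.+1 c -> (s.1 < b`_j) = (t.1 < b`_j).
Proof.
move=> ltj sc /close_dist st; apply: contraNeq => sep.
by apply/(touchesP _ ltj); exists s => //; apply: dist1_separated st sep.
Qed.

Definition touches_upto (b : seq int) (i : nat) (c : {fset tile}) : bool :=
  has (fun k => touches b k c) (iota 1 i).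

Lemma touches_uptoS b i c :
  touches_upto b i.+1 c = touches_upto b i c || touches b i.+1 c.
Proof.
rewrite /touches_upto -[i.+1 in LHS]addn1 iotaD has_cat.
by rewrite /= add1n orbF.
Qed.

(** * Processing one border *)

Section Step.
Variables (b : seq int) (S : {fset tile}) (j : nat) (P Js : {fset {fset tile}}).
Hypotheses (sb : sorted (fun x y : int => x < y) b) (ltj : (j < size b)%N).
Hypothesis clP : clustering b S j.+1 P.
Hypothesis joinJs : join [fset c in P | touches b j.+1 c] Js.

Let P' : {fset {fset tile}} := [fset c in P | ~~ touches b j.+1 c] `|` Js.

Let candP c : (c \in [fset c in P | touches b j.+1 c]) =
  (c \in P) && touches b j.+1 c.
Proof. by rewrite !inE. Qed.

Let P'P c : reflect (c \in P /\ ~~ touches b j.+1 c \/ c \in Js) (c \in P').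
Proof.
rewrite !inE /=; apply: (iffP orP) => -[]; auto; first by move/andP; auto.
by case=> -> ->; auto.
Qed.

(** The constituent containing [t] also has a tile in a column next to the current border, hence
    right of every earlier one, and it lies on a single side of each. *)
Lemma joined_right J t m : J \in Js -> t \in J -> (m < j)%N -> b`_m <= t.1.
Proof.
have [JsP _ _ _ _] := joinP joinJs => JJs tJ ltmj.
have [c []] := JsP J t JJs tJ; rewrite candP => /andP[cP].
case/(touchesP _ ltj)=> u uc ub tc _.
have ltm : b`_m < b`_j by apply: border_lt => //; rewrite ltmj.
rewrite leNgt -(clustering_side clP cP uc tc (leqW ltmj)) -leNgt.
(* Over the integers [x < y] gives [x <= y - 1], so even the column just left of the current border
   is not left of an earlier one. *)
have le_int (x y z : int) : x < y -> z = y - 1 \/ z = y -> x <= z by lia.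
exact: le_int ltm ub.
Qed.

(** The algorithm tests a joined cluster against the next border only. This suffices: its tiles are
    not left of that border, while the columns of still earlier borders are. *)
Lemma joined_touches_upto J : J \in Js -> touches_upto b j J = touches b j J.
Proof.
move=> JJs; case: j ltj (@joined_right J) => [|i] lti right; first by [].
rewrite touches_uptoS orbC; have [//|ntJ] := boolP (touches b i.+1 J).
apply/negbTE/hasPn => k; rewrite mem_iota; case: k => // k /andP[_ ltki'].
have ltki : (k < i)%N := ltki'.
have lti' : (i < size b)%N := ltnW lti.
apply/negP => /touchesP[|t tJ tk]; first exact: ltn_trans ltki lti'.
have ltk : b`_k < b`_i by apply: border_lt => //; rewrite ltki.
have lt_int (x y z : int) : x < y -> z = x - 1 \/ z = x -> z < y by lia.
have := right t i JJs tJ (ltnSn i).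
by rewrite leNgt => /negP[]; apply: lt_int ltk tk.
Qed.

Lemma clustering_join : clustering b S j P'.
Proof.
have [JsP UJs Js0 JsE JsI] := joinP joinJs.
(* A cluster not touching the removed border has no close tile across it, so the old invariant still
   applies. *)
have ntE c : c \in P -> ~~ touches b j.+1 c -> forall d s t, d \in P ->
    s \in c -> t \in d -> close s t -> same_side b j s t -> c = d.
  move=> cP ntc d s t dP sc td st side.
  apply: (clustering_close clP cP dP sc td st) => m; rewrite ltnS leq_eqVlt.
  case/orP=> [/eqP->|]; last exact: side.
  exact: close_separated ltj sc st ntc.
have mixed c J s t : c \in P -> ~~ touches b j.+1 c -> J \in Js ->
    s \in c -> t \in J -> close s t -> same_side b j s t -> False.
  move=> cP ntc JJs sc /(JsP _ _ JJs)[d []]; rewrite candP => /andP[dP tbd] td _.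
  by move=> st /(ntE c cP ntc d s t dP sc td st) cd; rewrite cd tbd in ntc.
have side_sym s t : same_side b j s t -> same_side b j t s.
  by move=> side m /side.
split.
- move=> t /(clustering_cover clP)[c cP tc].
  have [tbc|ntc] := boolP (touches b j.+1 c); last first.
    by exists c => //; apply/P'P; left.
  have [|J JJs cJ] := UJs c; first by rewrite candP cP.
  by exists J; [apply/P'P; right | apply: (fsubsetP cJ)].
- move=> c /P'P[[cP _]|cJs]; first exact (clustering_sub clP cP).
  apply/fsubsetP => t /(JsP _ _ cJs)[d []]; rewrite candP => /andP[dP _] td _.
  exact: (fsubsetP (clustering_sub clP dP)).
- move=> c /P'P[[cP _]|cJs]; first exact (clustering_neq0 clP cP).
  have [d] := Js0 c cJs; rewrite candP => /andP[dP _] dc.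
  by have [t td] := clustering_neq0 clP dP; exists t; apply: (fsubsetP dc).
- move=> c s t /P'P[[cP _]|cJs] sc tc m ltmj.
    exact: (clustering_side clP cP sc tc (leqW ltmj)).
  (* Every tile of a joined cluster is right of all remaining borders. *)
  by rewrite !ltNge !(joined_right cJs).
- move=> c d s t /P'P[[cP ntc]|cJs] /P'P[[dP ntd]|dJs] sc td st side.
  + exact: ntE sc td st side.
  + by case: (mixed c d s t).
  + by case: (mixed d c t s) => //; [apply: close_sym | apply: side_sym].
  apply: (JsE _ c d s t) => // e f u; rewrite !candP => /andP[eP _] /andP[fP _].
  (* Disjointness of the candidates is the equality case of [close]. *)
  by move=> ue uf; apply: (clustering_close clP eP fP ue uf); [left | ].
- move=> c /P'P[[cP _]|cJs]; first exact (clustering_indivisible clP cP).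
  apply: JsI cJs => d; rewrite candP => /andP[dP _]; split.
    exact (clustering_sub clP dP).
  exact (clustering_indivisible clP dP).
Qed.

End Step.

(** * Iteration over all borders *)

Lemma join_bordersP b mu S i P res : sorted (fun x y : int => x < y) b ->
  (i <= size b)%N -> clustering b S i P ->
  join_borders b mu i [fset c in P | touches_upto b i c]
    (large_clusters mu [fset c in P | ~~ touches_upto b i c]) res <->
  res = large_clusters mu (clusters S).
Proof.
move=> sb; elim: i => [|i IHi] in P * => lti clP /=.
  rewrite -(clustering0 clP).
  suff -> : [fset c in P | ~~ touches_upto b 0 c] = P by [].
  by apply/fsetP => c; rewrite !inE /= andbT.
have candE : [fset c in [fset c in P | touches_upto b i.+1 c] | touches b i.+1 c]
    = [fset c in P | touches b i.+1 c].
  apply/fsetP => c; rewrite !inE /= touches_uptoS.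
  by case: touches; rewrite ?orbT ?andbT ?andbF.
rewrite candE.
(* Stated for every grouping [Js], so the search order cannot affect the result. *)
have step Js : join [fset c in P | touches b i.+1 c] Js ->
  join_borders b mu i
    ([fset c in [fset c in P | touches_upto b i.+1 c] | ~~ touches b i.+1 c]
      `|` [fset c in Js | touches b i c])
    (large_clusters mu [fset c in P | ~~ touches_upto b i.+1 c]
      `|` large_clusters mu [fset c in Js | ~~ touches b i c]) res <->
  res = large_clusters mu (clusters S).
  move=> joinJs; have upto := joined_touches_upto sb lti clP joinJs.
  rewrite -(IHi _ (ltnW lti) (clustering_join sb lti clP joinJs)).
  set C1 := (X in join_borders _ _ _ X _ _).
  set C2 := [fset c in _ | touches_upto _ _ _].
  set O1 := (X in join_borders _ _ _ C1 X _).
  set O2 := (X in _ <-> join_borders _ _ _ _ X _).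
  (* With [upto] identifying the two touching tests on joined clusters, membership reduces to
     Boolean identities. *)
  suff [-> ->] : C1 = C2 /\ O1 = O2 by [].
  split; apply/fsetP => c; rewrite !inE /= touches_uptoS.
    case: (boolP (c \in Js)) => [/upto->|_]; case: (c \in P);
    by case: touches => //=; case: touches_upto => //=; case: touches.
  case: (boolP (c \in Js)) => [/upto->|_]; case: (c \in P); case: leq => //=;
  by case: touches => //=; case: touches_upto => //=; case: touches.
(* Any given run yields the result; conversely [join_ex] supplies a run. *)
split=> [[Js joinJs /(step _ joinJs)]//|resE].
have [Js joinJs] := join_ex [fset c in P | touches b i.+1 c].
by exists Js => //; apply/(step _ joinJs).
Qed.

Lemma prasterP b mu S res : sorted (fun x y : int => x < y) b ->
  praster b mu S res <-> res = large_clusters mu (clusters S).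
Proof.
(* [touches_some b] unfolds to [touches_upto b (size b)], so [praster] starts in the state described
   by the invariant. *)
by move=> sb; apply: join_bordersP (leqnn _) (slice_clusters_clustering S sb).
Qed.

Theorem theorem3 (S : {fset tile}) (mu N : nat) (hN : (1 <= N)%N)
    (b : N.-1.-tuple int) (hb : sorted (fun x y : int => x < y) b) :
  (forall res : {fset {fset tile}},
     praster b mu S res <-> praster [::] mu S res) /\
  (forall res : {fset {fset tile}},
     praster [::] mu S res <-> res = large_clusters mu (clusters S)).
Proof. by split=> res; rewrite !prasterP. Qed.
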